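(* Let $L$ be a finite lattice and $\mathbf{m}$ a maximal chain $\hat0=m_0\lessdot m_1\lessdot\cdots\lessdot m_n=\hat1$. If each $m_i$ is left-modular, and each two-element chain $m_i\lessdot m_{i+1}$ is right chain-modular (i.e. $m_i\vee(z\wedge m_{i+1})=(m_i\vee z)\wedge m_{i+1}$ for all $z\in L$), then $\mathbf{m}$ is chain-modular.
   Context: An element $m\in L$ is left-modular if for all $x<y$ in $L$ one has $x\vee(m\wedge y)=(x\vee m)\wedge y$. A chain $\mathbf{m}$ in $L$ is right chain-modular if for every pair $x<y$ of elements of $\mathbf{m}$ and every $z\in L$ one has $x\vee(z\wedge y)=(x\vee z)\wedge y$. A chain is chain-modular if it is right chain-modular and each of its elements is left-modular. $\lessdot$ denotes the cover relation. *)

(* Defs.v *)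
From mathcomp Require Import all_boot all_order.

Set Implicit Arguments.
Unset Strict Implicit.
Unset Printing Implicit Defensive.

Import Order.TTheory.
Local Open Scope order_scope.

Definition covers (d : Order.disp_t) (L : finPOrderType d) (x y : L) : bool :=
  (x < y) && [forall z : L, ~~ ((x < z) && (z < y))].

Definition is_chain (d : Order.disp_t) (L : finPOrderType d)
    (C : {set L}) : bool :=
  [forall x in C, forall y in C, x >=< y].

Definition maximal_chain (d : Order.disp_t) (L : finPOrderType d)
    (C : {set L}) : bool :=
  maxset (@is_chain d L) C.

Definition left_modular (d : Order.disp_t) (L : finLatticeType d)
    (m : L) : Prop :=
  forall x y : L, x < y -> x `|` (m `&` y) = (x `|` m) `&` y.

Definition right_chain_modular (d : Order.disp_t) (L : finLatticeType d)
    (C : {set L}) : Prop :=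
  is_chain C /\
  forall x y : L, x \in C -> y \in C -> x < y ->
  forall z : L, x `|` (z `&` y) = (x `|` z) `&` y.

Definition chain_modular (d : Order.disp_t) (L : finLatticeType d)
    (C : {set L}) : Prop :=
  right_chain_modular C /\ forall m : L, m \in C -> left_modular m.

(* Main.v *)
(** A left-modular element [b] separates comparable elements: if [p <= q] have
    the same meet and the same join with [b], then [p = q].  For [a <= b <= c]
    with [a, b] and [b, c] right chain-modular, the two sides of the identity
    for [a, c] both meet [b] in [a `|` (z `&` b)] and both join with [b] to
    [(b `|` z) `&` c], so they agree; hence the identity propagates along
    the chain. *)
Require Import Defs.
From mathcomp Require Import all_boot all_order.

Set Implicit Arguments.
Unset Strict Implicit.
Unset Printing Implicit Defensive.

Import Order.TTheory.
Local Open Scope order_scope.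

Lemma left_modular_separates (d : Order.disp_t) (L : finLatticeType d)
    (b p q : L) :
  left_modular b -> p <= q -> p `&` b = q `&` b -> p `|` b = q `|` b -> p = q.
Proof.
move=> b_left; rewrite le_eqVlt => /orP[/eqP //|ltpq] eq_meet eq_join.
have := b_left _ _ ltpq.
(* Absorption reduces the left side to [p] and the right side to [q]. *)
by rewrite (meetC b) -eq_meet eq_join (join_l (leIl _ _)) (meet_r (leUl _ _)).
Qed.

(** The order is weak so that an induction along the chain can start from equal endpoints. *)
Definition right_modular_pair (d : Order.disp_t) (L : finLatticeType d)
    (x y : L) : Prop :=
  x <= y /\ forall z : L, x `|` (z `&` y) = (x `|` z) `&` y.

Lemma right_modular_pair_refl (d : Order.disp_t) (L : finLatticeType d)
    (x : L) :
  right_modular_pair x x.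
Proof. by split=> // z; rewrite (join_l (leIr _ _)) (meet_r (leUl _ _)). Qed.

Lemma right_modular_pair_trans (d : Order.disp_t) (L : finLatticeType d)
    (a b c : L) :
  left_modular b -> right_modular_pair a b -> right_modular_pair b c ->
  right_modular_pair a c.
Proof.
move=> b_left [leab mod_ab] [lebc mod_bc]; have leac := le_trans leab lebc.
split=> // z; apply: (left_modular_separates b_left).
- by rewrite leUx !lexI leac leUl leIr lexUr ?leIl.
- by rewrite -mod_ab -!meetA (meet_r lebc) mod_ab.
(* [mod_bc] is applied twice: to [z], and to the join of [a] and [z], where [b] absorbs [a]. *)
- rewrite joinAC (join_r leab) [RHS]joinC !mod_bc.
  by rewrite joinA (join_l leab).
Qed.

Lemma right_modular_pair_chain (d : Order.disp_t) (L : finLatticeType d)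
    (n : nat) (m : 'I_n.+1 -> L) :
  (forall i, left_modular (m i)) ->
  (forall i j : 'I_n.+1, j = i.+1 :> nat -> right_modular_pair (m i) (m j)) ->
  forall i j : 'I_n.+1, (i <= j)%N -> right_modular_pair (m i) (m j).
Proof.
move=> m_left m_step i [j lt_jn] /=.
elim: j lt_jn => [|j IHj] lt_jn.
  rewrite leqn0 => /eqP i0.
  have -> : i = Ordinal lt_jn by apply: val_inj.
  exact: right_modular_pair_refl.
rewrite leq_eqVlt => /orP[/eqP eq_ij|lt_ij].
  have -> : i = Ordinal lt_jn by apply: val_inj.
  exact: right_modular_pair_refl.
(* Split at the predecessor of the upper index: the induction hypothesis covers the lower part, one
   cover step the rest. *)
apply: (right_modular_pair_trans (m_left (Ordinal (ltnW lt_jn)))).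
  exact: IHj.
exact: m_step.
Qed.

Theorem theorem5p2 (d : Order.disp_t) (L : finTBLatticeType d) (n : nat)
    (m : 'I_n.+1 -> L)
    (m_max : maximal_chain [set m i | i : 'I_n.+1])
    (m_bot : m ord0 = \bot)
    (m_top : m ord_max = \top)
    (m_cov : forall i j : 'I_n.+1, j = i.+1 :> nat -> covers (m i) (m j))
    (m_left : forall i : 'I_n.+1, left_modular (m i))
    (m_right : forall i j : 'I_n.+1, j = i.+1 :> nat ->
       right_chain_modular [set m i; m j]) :
  chain_modular [set m i | i : 'I_n.+1].
Proof.
have m_step (i j : 'I_n.+1) : j = i.+1 :> nat -> right_modular_pair (m i) (m j).
  move=> eq_j; have /andP[ltij _] := m_cov i j eq_j.
  have [_ mod_ij] := m_right i j eq_j; split; first exact: ltW.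
  by apply: mod_ij; rewrite // !inE eqxx ?orbT.
have m_pair := right_modular_pair_chain m_left m_step.
split; last by move=> _ /imsetP[i _ ->].
split; first exact: maxsetp m_max.
move=> _ _ /imsetP[i _ ->] /imsetP[j _ ->] lt_mij.
(* The indices come unordered; [j < i] would give [m j <= m i], against [lt_mij]. *)
have [/m_pair[] //|/ltnW/m_pair[le_mji _]] := leqP i j.
by rewrite (le_gtF le_mji) in lt_mij.
Qed.
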